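(* Let $n\ge 1$ and $\sigma_1\ge\dots\ge\sigma_{n-1}\ge 1$, and let $\phi$ be the Lorentzian inner product on the Heisenberg Lie algebra $\mathfrak{h}_{2n+1}$ represented in the basis $\{f_1,g_1,\dots,f_n,g_n,z\}$ by the block diagonal matrix with blocks $\operatorname{diag}\{\sigma_1,\sigma_1,\dots,\sigma_{n-1},\sigma_{n-1}\}$ and $\begin{bmatrix}1&0&0\\0&0&1\\0&1&0\end{bmatrix}$. Let $\mathscr{B}=\{v_1,\dots,v_{2n+1}\}$ be the orthonormal basis given by $v_{2k-1}=\frac{1}{\sqrt{\sigma_k}}f_k$, $v_{2k}=\frac{1}{\sqrt{\sigma_k}}g_k$ for $1\le k\le n-1$, $v_{2n-1}=f_n$, $v_{2n}=\frac{1}{\sqrt2}(g_n+z)$, $v_{2n+1}=\frac{1}{\sqrt2}(g_n-z)$. Then the Ricci operator of $(\mathfrak{h}_{2n+1},\phi)$ is represented in the basis $\mathscr{B}$ by the $(2n+1)\times(2n+1)$ matrix whose lower right $2\times2$ block (corresponding to $v_{2n},v_{2n+1}$) is $$\begin{bmatrix}\alpha&\alpha\\-\alpha&-\alpha\end{bmatrix},\qquad \alpha=\sum_{k=1}^{n-1}\frac{1}{4\sigma_k^2},$$ and all of whose other entries are zero; that is, $\operatorname{Ric}(v_i)=0$ for $i=1,\dots,2n-1$ and $\operatorname{Ric}(v_{2n})=\operatorname{Ric}(v_{2n+1})=\alpha v_{2n}-\alpha v_{2n+1}$.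
   Context: The Heisenberg Lie algebra $\mathfrak{h}_{2n+1}$ is the real Lie algebra with basis $\{f_1,g_1,\dots,f_n,g_n,z\}$ whose only nonzero brackets of basis elements (up to antisymmetry) are $[f_i,g_i]=z$, $i=1,\dots,n$. For $n=1$ there are no $\sigma_k$ (and the empty sum is $0$). A Lorentzian inner product is a nondegenerate symmetric bilinear form of signature $(2n,1)$; an orthonormal basis $\{v_1,\dots,v_m\}$ satisfies $\langle v_i,v_j\rangle=0$ for $i\ne j$, $\langle v_i,v_i\rangle=1$ for $i<m$, and $\langle v_m,v_m\rangle=-1$. The Levi-Civita connection of $(\mathfrak{g},\langle\cdot,\cdot\rangle)$ is the bilinear map $(u,v)\mapsto\nabla_uv$ on $\mathfrak{g}$ determined by the Koszul formula $2\langle\nabla_uv,w\rangle=\langle[u,v],w\rangle+\langle[w,u],v\rangle+\langle[w,v],u\rangle$. The curvature is $R_{uv}w=\nabla_{[u,v]}w-\nabla_u\nabla_vw+\nabla_v\nabla_uw$, and the Ricci operator is $\operatorname{Ric}(u)=\sum_{k=1}^{m}\langle v_k,v_k\rangle R_{v_ku}v_k$ for an orthonormal basis $\{v_1,\dots,v_m\}$. *)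

(* Defs.v *)
From HB Require Import structures.
From mathcomp Require Import all_boot all_order all_algebra.
From mathcomp Require Import reals.
From mathcomp Require Import ring lra zify.
Set Implicit Arguments.
Unset Strict Implicit.
Unset Printing Implicit Defensive.
Import Order.TTheory GRing.Theory Num.Theory.
Local Open Scope ring_scope.

Section LorentzianLieAlgebras.
Variables (R : realType) (V : vectType R).

Definition is_bilinear (b : V -> V -> V) : Prop :=
  (forall u, linear (b u)) /\ (forall v, linear (b^~ v)).

Definition is_bilinear_form (phi : V -> V -> R) : Prop :=
  (forall u, scalar (phi u)) /\ (forall v, scalar (phi^~ v)).

Definition is_lie_bracket (br : V -> V -> V) : Prop :=
  [/\ is_bilinear br,
      forall u, br u u = 0 &
      forall u v w, br u (br v w) + br v (br w u) + br w (br u v) = 0].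

(* The timelike vector comes last. *)
Definition orthonormal_basis (phi : V -> V -> R) m (e : 'I_m.+1 -> V) : Prop :=
  basis_of fullv [tuple e i | i < m.+1] /\
  forall i j, phi (e i) (e j) =
    if i == j then (if i == ord_max then -1 else 1) else 0.

(* By Sylvester's law of inertia, having signature (m, 1) means having a
   basis in which the form is diag(1, ..., 1, -1). *)
Definition is_lorentzian (phi : V -> V -> R) m : Prop :=
  [/\ is_bilinear_form phi,
      forall u v, phi u v = phi v u,
      forall u, (forall v, phi u v = 0) -> u = 0 &
      exists e : 'I_m.+1 -> V, orthonormal_basis phi e].

Definition is_levi_civita (br : V -> V -> V) (phi : V -> V -> R)
    (nabla : V -> V -> V) : Prop :=
  is_bilinear nabla /\
  forall u v w, 2 * phi (nabla u v) w =
    phi (br u v) w + phi (br w u) v + phi (br w v) u.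

Definition curvature (br nabla : V -> V -> V) (u v w : V) : V :=
  nabla (br u v) w - nabla u (nabla v w) + nabla v (nabla u w).

Definition ricci (br : V -> V -> V) (phi : V -> V -> R) (nabla : V -> V -> V)
    m (e : 'I_m.+1 -> V) (u : V) : V :=
  \sum_(k < m.+1) phi (e k) (e k) *: curvature br nabla (e k) u (e k).

(* Column j of M holds the coordinates of T (b j). *)
Definition represented_by m (b : 'I_m -> V) (T : V -> V) (M : 'M[R]_m) : Prop :=
  basis_of fullv [tuple b i | i < m] /\
  forall j, T (b j) = \sum_(i < m) M i j *: b i.

Lemma scalar_sum (f : V -> R) m (c : 'I_m -> R) (x : 'I_m -> V) :
  scalar f -> f (\sum_(i < m) c i *: x i) = \sum_(i < m) c i * f (x i).
Proof.
move=> lf.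
have f0 : f 0 = 0 by have := lf (-1) 0 0; rewrite scaler0 addr0; lra.
have fD a b : f (a + b) = f a + f b by have := lf 1 a b; rewrite scale1r mul1r.
rewrite (big_morph f fD f0); apply: eq_bigr => i _.
by have := lf (c i) (x i) 0; rewrite !addr0 f0 addr0.
Qed.

Lemma orthonormal_expansion (phi : V -> V -> R) m (e : 'I_m.+1 -> V) u :
  is_bilinear_form phi -> orthonormal_basis phi e ->
  u = \sum_(k < m.+1) (phi (e k) (e k) * phi u (e k)) *: e k.
Proof.
move=> [_ lin] [bas orth].
have tn (k : 'I_m.+1) : [tuple e i | i < m.+1]`_k = e k.
  by rewrite -tnth_nth tnth_mktuple.
have uE : u = \sum_(k < m.+1) coord [tuple e i | i < m.+1] k u *: e k.
  rewrite {1}(coord_basis bas (memvf u)).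
  by apply: eq_bigr => k _; rewrite tn.
rewrite {1}uE; apply: eq_bigr => k _; congr (_ *: _).
have -> : phi u (e k) = coord [tuple e i | i < m.+1] k u * phi (e k) (e k).
  rewrite {1}uE (scalar_sum _ _ (lin (e k))) (bigD1 k) //=.
  by rewrite big1 ?addr0 // => i ik; rewrite orth (negbTE ik) mulr0.
rewrite mulrCA orth eqxx; case: ifP => _; ring.
Qed.

Lemma gram_basis (phi : V -> V -> R) m (e : 'I_m.+1 -> V) :
  is_bilinear_form phi -> \dim {:V} = m.+1 ->
  (forall i j, phi (e i) (e j) =
     if i == j then (if i == ord_max then -1 else 1) else 0) ->
  orthonormal_basis phi e.
Proof.
move=> [_ lin] dimV orth; split=> //.
rewrite basisEfree subvf dimV size_tuple leqnn !andbT.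
apply/freeP => c c0 j.
have s0 : \sum_(i < m.+1) c i *: e i = 0.
  by rewrite -[RHS]c0; apply: eq_bigr => i _; rewrite -tnth_nth tnth_mktuple.
have := congr1 (phi^~ (e j)) s0; have := lin (e j) (-1) 0 0.
rewrite scaler0 addr0 => f0.
rewrite (scalar_sum _ _ (lin (e j))) (bigD1 j) //= big1 ?addr0.
  by rewrite orth eqxx; case: ifP => _; lra.
by move=> i ij; rewrite orth (negbTE ij) mulr0.
Qed.

Lemma levi_civita_exists (br : V -> V -> V) (phi : V -> V -> R) m :
  is_lie_bracket br -> is_lorentzian phi m ->
  exists nabla, is_levi_civita br phi nabla.
Proof.
move=> [[br1 br2] _ _] [[p1 p2] psym _ [e he]].
pose K u v w := phi (br u v) w + phi (br w u) v + phi (br w v) u.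
have K1 v w a x y : K (a *: x + y) v w = a * K x v w + K y v w.
  by rewrite /K (br2 v) p2 (br1 w) p2 p1; ring.
have K2 u w a x y : K u (a *: x + y) w = a * K u x w + K u y w.
  by rewrite /K (br1 u) p2 p1 (br1 w) p2; ring.
have K3 u v a x y : K u v (a *: x + y) = a * K u v x + K u v y.
  by rewrite /K p1 (br2 u) p2 (br2 v) p2; ring.
pose c k := phi (e k) (e k) / 2.
exists (fun u v => \sum_(k < m.+1) (c k * K u v (e k)) *: e k); split; [split|].
- move=> u a x y; rewrite scaler_sumr -big_split /=; apply: eq_bigr => k _.
  by rewrite K2 scalerA -scalerDl; congr (_ *: _); ring.
- move=> v a x y; rewrite scaler_sumr -big_split /=; apply: eq_bigr => k _.
  by rewrite K1 scalerA -scalerDl; congr (_ *: _); ring.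
- move=> u v w; rewrite -/(K u v w).
  rewrite (scalar_sum _ _ (p2 w)).
  rewrite [in RHS](orthonormal_expansion w (conj p1 p2) he) (scalar_sum _ _ (K3 u v)).
  rewrite mulr_sumr; apply: eq_bigr => k _.
  by rewrite /c (psym (e k) w); field.
Qed.

Lemma levi_civita_unique (br : V -> V -> V) (phi : V -> V -> R) m n1 n2 :
  is_lorentzian phi m -> is_levi_civita br phi n1 -> is_levi_civita br phi n2 ->
  forall u v, n1 u v = n2 u v.
Proof.
move=> [[_ p2] _ nd _] [_ h1] [_ h2] u v.
apply/eqP; rewrite -subr_eq0; apply/eqP; apply: nd => w.
have -> : n1 u v - n2 u v = (-1) *: n2 u v + n1 u v by rewrite scaleN1r addrC.
by rewrite p2; have := h1 u v w; have := h2 u v w; lra.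
Qed.

End LorentzianLieAlgebras.

(* The basis f_1, g_1, ..., f_n, g_n, z is the canonical basis of R^(2n+1);
   the index k of f_k and g_k ranges over 1 <= k <= n. *)
Section Heisenberg.
Variables (R : realType) (n : nat).

Local Notation heis := 'rV[R]_(n.*2.+1).

Definition fidx (k : nat) : 'I_(n.*2.+1) := inord k.-1.*2.
Definition gidx (k : nat) : 'I_(n.*2.+1) := inord k.-1.*2.+1.
Definition zidx : 'I_(n.*2.+1) := ord_max.

Definition heis_f (k : nat) : heis := delta_mx 0 (fidx k).
Definition heis_g (k : nat) : heis := delta_mx 0 (gidx k).
Definition heis_z : heis := delta_mx 0 zidx.

Definition heis_bracket (u v : heis) : heis :=
  (\sum_(1 <= k < n.+1)
     (u 0 (fidx k) * v 0 (gidx k)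
    - u 0 (gidx k) * v 0 (fidx k)))
  *: heis_z.

(* sigma 1, ..., sigma n.-1 are the parameters; other values are not used. *)
Variable sigma : nat -> R.

Definition form_mx : 'M[R]_(n.*2.+1) :=
  \matrix_(i, j)
    if (i < n.-1.*2)%N then (if i == j then sigma (i./2).+1 else 0)
    else if (j < n.-1.*2)%N then 0
    else ((i - n.-1.*2, j - n.-1.*2)%N \in [:: (0, 0); (1, 2); (2, 1)]%N)%:R.

Definition heis_form (u v : heis) : R := (u *m form_mx *m v^T) 0 0.

(* Ordinals count from 0: frame i is the vector v_(i+1). *)
Definition frame (i : 'I_(n.*2.+1)) : heis :=
  if (i < n.-1.*2)%N then
    (Num.sqrt (sigma (i./2).+1))^-1 *:
      (if odd i then heis_g (i./2).+1 else heis_f (i./2).+1)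
  else if i == n.-1.*2 :> nat then heis_f n
  else if i == n.-1.*2.+1 :> nat then (Num.sqrt 2)^-1 *: (heis_g n + heis_z)
  else (Num.sqrt 2)^-1 *: (heis_g n - heis_z).

Definition alpha : R := \sum_(1 <= k < n) 1 / (4 * sigma k ^+ 2).

Definition ricci_mx : 'M[R]_(n.*2.+1) :=
  \matrix_(i, j)
    if (n.*2.-1 <= i)%N && (n.*2.-1 <= j)%N then
      (if i == ord_max then - alpha else alpha)
    else 0.

Lemma fidxE k : (1 <= k <= n)%N -> fidx k = k.-1.*2 :> nat.
Proof. by move=> hk; rewrite inordK //; lia. Qed.

Lemma gidxE k : (1 <= k <= n)%N -> gidx k = k.-1.*2.+1 :> nat.
Proof. by move=> hk; rewrite inordK //; lia. Qed.

Lemma heis_bracket_lie : is_lie_bracket heis_bracket.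
Proof.
pose om (u v : 'rV[R]_(n.*2.+1)) := \sum_(1 <= k < n.+1)
  (u 0 (fidx k) * v 0 (gidx k) - u 0 (gidx k) * v 0 (fidx k)).
have brE u v : heis_bracket u v = om u v *: heis_z by [].
have o1 u a x y : om u (a *: x + y) = a * om u x + om u y.
  rewrite /om mulr_sumr -big_split /=; apply: eq_bigr => k _.
  by rewrite !mxE; ring.
have o2 v a x y : om (a *: x + y) v = a * om x v + om y v.
  rewrite /om mulr_sumr -big_split /=; apply: eq_bigr => k _.
  by rewrite !mxE; ring.
have oz u : om u heis_z = 0.
  rewrite /om big_nat big1 // => k hk; rewrite /heis_z !mxE !eqxx /=.
  have hk' : (1 <= k <= n)%N by lia.
  have -> : (gidx k == zidx) = false.
    by apply/eqP => /(congr1 val); rewrite /= gidxE //; lia.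
  have -> : (fidx k == zidx) = false.
    by apply/eqP => /(congr1 val); rewrite /= fidxE //; lia.
  by rewrite !mulr0 subr0.
have oZ u a : om u (a *: heis_z) = 0.
  have := o1 u a heis_z 0; rewrite addr0 => ->.
  have := o1 u (-1) heis_z heis_z.
  rewrite scaleN1r addNr oz => ->; ring.
split; first split.
- by move=> u a x y; rewrite !brE o1 scalerDl scalerA.
- by move=> u a x y; rewrite !brE o2 scalerDl scalerA.
- move=> u; rewrite brE /om big1 ?scale0r // => k _; ring.
- by move=> u v w; rewrite !brE !oZ !scale0r !addr0.
Qed.

Lemma heis_bracket_basis (i j : nat) :
  (1 <= i <= n)%N -> (1 <= j <= n)%N ->
  [/\ heis_bracket (heis_f i) (heis_g j) = (if i == j then heis_z else 0),
      heis_bracket (heis_f i) (heis_f j) = 0,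
      heis_bracket (heis_g i) (heis_g j) = 0,
      heis_bracket (heis_f i) heis_z = 0 &
      heis_bracket (heis_g i) heis_z = 0].
Proof.
move=> hi hj.
have ff k l : (1 <= k <= n)%N -> (1 <= l <= n)%N -> (fidx k == fidx l) = (k == l).
  by move=> hk hl; rewrite -val_eqE /= !fidxE //; lia.
have gg k l : (1 <= k <= n)%N -> (1 <= l <= n)%N -> (gidx k == gidx l) = (k == l).
  by move=> hk hl; rewrite -val_eqE /= !gidxE //; lia.
have fg k l : (1 <= k <= n)%N -> (1 <= l <= n)%N -> (fidx k == gidx l) = false.
  by move=> hk hl; rewrite -val_eqE /= fidxE // gidxE //; lia.
have gf k l : (1 <= k <= n)%N -> (1 <= l <= n)%N -> (gidx k == fidx l) = false.
  by move=> hk hl; rewrite eq_sym fg.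
have fz k : (1 <= k <= n)%N -> (fidx k == zidx) = false.
  by move=> hk; rewrite -val_eqE /= fidxE //; lia.
have gz k : (1 <= k <= n)%N -> (gidx k == zidx) = false.
  by move=> hk; rewrite -val_eqE /= gidxE //; lia.
have zero (S : R) (b : heis) : S = 0 -> S *: b = 0 by move->; rewrite scale0r.
split; last 4 first.
1-4: apply: zero; rewrite big_nat big1 // => k hk;
  have {}hk : (1 <= k <= n)%N by [];
  by rewrite !mxE ?eqxx ?gf ?fg ?fz ?gz //= ?mulr0 ?mul0r ?subr0.
rewrite /heis_bracket big_nat.
have -> : \sum_(1 <= k < n.+1 | (1 <= k < n.+1)%N)
   (heis_f i 0 (fidx k) * heis_g j 0 (gidx k) -
    heis_f i 0 (gidx k) * heis_g j 0 (fidx k))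
   = \sum_(1 <= k < n.+1 | (1 <= k < n.+1)%N) (if k == i then (i == j)%:R else 0).
  apply: eq_bigr => k hk; have {}hk : (1 <= k <= n)%N by [].
  rewrite !mxE !eqxx /= ff // gg // gf // fg // mul0r subr0.
  by case: eqVneq => [->|]; rewrite ?mul1r ?mul0r.
rewrite -big_nat -big_mkcond big_nat1_eq ltnS hi.
by case: eqP; rewrite ?scale1r ?scale0r.
Qed.

Hypothesis n_gt0 : (1 <= n)%N.
Hypothesis sigma_gt0 : forall k, (1 <= k < n)%N -> 0 < sigma k.

Lemma heis_form_bilinear : is_bilinear_form heis_form.
Proof.
split=> [u a x y|v a x y]; rewrite /heis_form.
- by rewrite linearD linearZ /= mulmxDr -scalemxAr !mxE.
- by rewrite !mulmxDl -!scalemxAl !mxE.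
Qed.

Lemma heis_form_delta (i j : 'I_(n.*2.+1)) :
  heis_form (delta_mx 0 i) (delta_mx 0 j) = form_mx i j.
Proof.
by rewrite /heis_form -rowE trmx_delta -colE !mxE.
Qed.

Lemma form_mx_sym (i j : 'I_(n.*2.+1)) : form_mx i j = form_mx j i.
Proof.
rewrite !mxE; have [<-|ij] := eqVneq i j; first by [].
have [hi|hi] := ltnP i n.-1.*2; have [hj|hj] := ltnP j n.-1.*2 => //.
by congr (_%:R); rewrite !inE !xpair_eqE; lia.
Qed.

Lemma heis_form_sym u v : heis_form u v = heis_form v u.
Proof.
have symM : form_mx^T = form_mx by apply/matrixP => i j; rewrite mxE form_mx_sym.
rewrite /heis_form -[in LHS]symM -[in LHS](trmxK u) -mulmxA -!trmx_mul.
by rewrite [LHS]mxE.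
Qed.

Lemma frame_orthonormal : orthonormal_basis heis_form frame.
Proof.
have [br bl] := heis_form_bilinear.
apply: gram_basis; [exact: heis_form_bilinear | by rewrite dimvf /dim /= mul1n |].
have form0l v : heis_form 0 v = 0 by rewrite /heis_form !mul0mx mxE.
have form0r u : heis_form u 0 = 0 by rewrite heis_form_sym form0l.
have Dl u v w : heis_form (u + v) w = heis_form u w + heis_form v w.
  by have := bl w 1 u v; rewrite scale1r mul1r.
have Dr u v w : heis_form w (u + v) = heis_form w u + heis_form w v.
  by rewrite !(heis_form_sym w) Dl.
have Zl a u w : heis_form (a *: u) w = a * heis_form u w.
  by have := bl w a u 0; rewrite !addr0 form0l addr0.
have Zr a u w : heis_form w (a *: u) = a * heis_form w u.
  by rewrite !(heis_form_sym w) Zl.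
have Nl u w : heis_form (- u) w = - heis_form u w by rewrite -scaleN1r Zl mulN1r.
have Nr u w : heis_form w (- u) = - heis_form w u by rewrite -scaleN1r Zr mulN1r.
have hn : (1 <= n <= n)%N by rewrite n_gt0 leqnn.
have s2 : (Num.sqrt 2 : R)^-1 * (Num.sqrt 2)^-1 = 1 / 2.
  by rewrite -invfM -expr2 sqr_sqrtr // mul1r.
have frameA (i : 'I_(n.*2.+1)) : (i < n.-1.*2)%N ->
    frame i = (Num.sqrt (sigma (i./2).+1))^-1 *: delta_mx 0 i.
  move=> hi; rewrite /frame hi; congr (_ *: _).
  have hk : (1 <= (i./2).+1 <= n)%N by lia.
  have f1 := fidxE hk; have g1 := gidxE hk.
  by case: ifP => oi; congr delta_mx; apply: val_inj => /=;
    [rewrite g1 | rewrite f1] => /=; lia.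
have frameB (i : 'I_(n.*2.+1)) : (n.-1.*2 <= i)%N ->
    [\/ i = fidx n /\ frame i = heis_f n,
        i = gidx n /\ frame i = (Num.sqrt 2)^-1 *: (heis_g n + heis_z) |
        i = zidx /\ frame i = (Num.sqrt 2)^-1 *: (heis_g n - heis_z)].
  move=> hi; rewrite /frame ltnNge hi /=.
  case: eqP => [e|ne1]; first by constructor 1; split=> //; apply: val_inj; rewrite [RHS]fidxE.
  case: eqP => [e|ne2]; first by constructor 2; split=> //; apply: val_inj; rewrite [RHS]gidxE.
  by constructor 3; split=> //; apply: val_inj => /=; have := ltn_ord i; lia.
have AB (i j : 'I_(n.*2.+1)) : (i < n.-1.*2)%N -> (n.-1.*2 <= j)%N -> form_mx i j = 0.
  by move=> hi hj; rewrite mxE hi ifN // -val_eqE /=; lia.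
have hF := fidxE hn; have hG := gidxE hn.
have hZ : zidx = n.-1.*2.+2 :> nat by rewrite /zidx /=; lia.
have BB (i j : 'I_(n.*2.+1)) a b : i = (n.-1.*2 + a)%N :> nat -> j = (n.-1.*2 + b)%N :> nat ->
    form_mx i j = ((a, b) \in [:: (0, 0); (1, 2); (2, 1)]%N)%:R.
  by move=> hi hj; rewrite mxE hi hj !ltnNge !leq_addr /= !addKn.
have FF := BB (fidx n) (fidx n) 0%N 0%N; have FG := BB (fidx n) (gidx n) 0%N 1%N.
have FZ := BB (fidx n) zidx 0%N 2%N; have GF := BB (gidx n) (fidx n) 1%N 0%N.
have GG := BB (gidx n) (gidx n) 1%N 1%N; have GZ := BB (gidx n) zidx 1%N 2%N.
have ZF := BB zidx (fidx n) 2%N 0%N; have ZG := BB zidx (gidx n) 2%N 1%N.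
have ZZ := BB zidx zidx 2%N 2%N.
rewrite !addn0 !addn1 !addn2 in FF FG FZ GF GG GZ ZF ZG ZZ.
have {}FF := FF hF hF; have {}FG := FG hF hG; have {}FZ := FZ hF hZ.
have {}GF := GF hG hF; have {}GG := GG hG hG; have {}GZ := GZ hG hZ.
have {}ZF := ZF hZ hF; have {}ZG := ZG hZ hG; have {}ZZ := ZZ hZ hZ.
have nFG : (fidx n == gidx n) = false by rewrite -val_eqE /= hF hG; lia.
have nFZ : (fidx n == zidx) = false by rewrite -val_eqE /= -/zidx hF; lia.
have nGZ : (gidx n == zidx) = false by rewrite -val_eqE /= hG; lia.
have FormAB (i j : 'I_(n.*2.+1)) : (i < n.-1.*2)%N -> (n.-1.*2 <= j)%N ->
    heis_form (frame i) (frame j) = 0.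
  move=> hi hj; rewrite frameA // Zl.
  have aF : form_mx i (fidx n) = 0 by apply: AB; lia.
  have aG : form_mx i (gidx n) = 0 by apply: AB; lia.
  have aZ : form_mx i zidx = 0 by apply: AB; lia.
  by case: (frameB j hj) => -[_ ->]; rewrite ?Zr ?Dr ?Nr !heis_form_delta
    ?aF ?aG ?aZ; ring.
move=> i j.
have [hi|hi] := ltnP i n.-1.*2; have [hj|hj] := ltnP j n.-1.*2.
- rewrite !frameA // Zl Zr heis_form_delta mxE hi.
  case: eqP => [<-|_]; last by rewrite !mulr0.
  have -> : (i == ord_max) = false by rewrite -val_eqE /=; lia.
  have s0 : 0 < sigma (i./2).+1 by apply: sigma_gt0; lia.
  by rewrite mulrA -invfM -expr2 sqr_sqrtr ?ltW // mulVf // gt_eqF.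
- by rewrite FormAB // ifN //; apply/eqP => e; move: hi; rewrite e ltnNge hj.
- by rewrite heis_form_sym FormAB // ifN //; apply/eqP => e; move: hj; rewrite -e ltnNge hi.
- by case: (frameB i hi) => -[-> ->]; case: (frameB j hj) => -[-> ->];
    rewrite -/zidx ?eqxx ?(eq_sym zidx) ?(eq_sym (gidx n) (fidx n)) ?nFG ?nFZ ?nGZ ?Zl ?Zr ?Dl ?Dr ?Nl ?Nr
      ?Dl ?Dr ?Nl ?Nr !heis_form_delta
      ?FF ?FG ?FZ ?GF ?GG ?GZ ?ZF ?ZG ?ZZ ?mulrA ?s2 /=
      ?subr0 ?addr0 ?sub0r ?add0r ?oppr0 ?mulr0 ?subrr ?addNr ?mulr0 //; lra.
Qed.

Lemma heis_form_lorentzian : is_lorentzian heis_form n.*2.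
Proof.
split; [exact: heis_form_bilinear | exact: heis_form_sym | |].
- move=> u u0; rewrite (orthonormal_expansion u heis_form_bilinear frame_orthonormal).
  by apply: big1 => k _; rewrite u0 mulr0 scale0r.
- by exists frame; exact: frame_orthonormal.
Qed.

End Heisenberg.

(* Main.v *)
Require Import Defs.
From mathcomp Require Import all_boot all_order all_algebra.
From mathcomp Require Import reals.
From mathcomp Require Import ring lra zify.
Import Order.TTheory GRing.Theory Num.Theory.
Local Open Scope ring_scope.

(** Write the bracket as [u,v] = omega(u,v) z.  Everything follows from the
    centre being null: <z,z> = 0.  Put theta(u) = <u,z>, let J be the
    skew operator with <Ju,w> = omega(u,w), and let g(u,v) = <Ju,Jv>.  Since
    Jz = 0, theta o J = 0 and theta(z) = 0, the Koszul formula becomes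
      2 nabla_u v = omega(u,v) z - theta(v) Ju - theta(u) Jv,
    so that nabla_z = 0 and nabla z = 0.  The curvature is then the
    Kulkarni-Nomizu type expression [curvature_null_center] in
    theta (x) theta and g.  Contracting it over an orthonormal basis kills
    every term in which theta is paired with theta (giving <z,z>) or with g
    (giving g(z,.)), and leaves ([ricci_null_center])
      Ric(u) = 1/4 tr(g) theta(u) z.

    The trace of g does not depend on the orthonormal basis
    ([orthonormal_trace_indep]), so it may be computed in the given frame.
    There f_k / sqrt(sigma_k) and g_k / sqrt(sigma_k) each contribute
    1 / sigma_k^2, f_n contributes <z,z> = 0, and the contributions of the
    last two vectors cancel because one of them is timelike.  Hence
    tr(g) = 8 alpha, and the matrix is read off from
    z = (v_2n - v_(2n+1)) / sqrt 2 and
    theta(v_2n) = theta(v_(2n+1)) = 1 / sqrt 2. *)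

(** * Contraction over an orthonormal basis *)

Section Contraction.
Variables (R : realType) (V : vectType R) (phi : V -> V -> R) (m : nat).
Hypothesis bil : is_bilinear_form phi.
Implicit Types e : 'I_m.+1 -> V.

(** Expanding y in the basis e turns f y into this sum: it is the rule by which
    a slot paired with e_k is filled with y. *)
Lemma orthonormal_contract e (f : V -> R) y :
  orthonormal_basis phi e -> scalar f ->
  \sum_(k < m.+1) phi (e k) (e k) * (phi y (e k) * f (e k)) = f y.
Proof.
move=> he lf; rewrite [in RHS](orthonormal_expansion y bil he) scalar_sum //.
by apply: eq_bigr => k _; rewrite mulrA.
Qed.

Lemma orthonormal_riesz e (f : V -> R) w :
  (forall u v, phi u v = phi v u) -> orthonormal_basis phi e -> scalar f ->
  phi (\sum_(k < m.+1) (phi (e k) (e k) * f (e k)) *: e k) w = f w.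
Proof.
move=> sym he lf; rewrite (scalar_sum _ _ (bil.2 w)).
rewrite -[RHS](orthonormal_contract e f w he lf).
by apply: eq_bigr => k _; rewrite (sym w); ring.
Qed.

(** Expand the second argument of b in the basis e', then resum over e: the
    two families are dual to each other through phi. *)
Lemma orthonormal_trace_indep e e' (b : V -> V -> R) :
  (forall u v, phi u v = phi v u) ->
  orthonormal_basis phi e -> orthonormal_basis phi e' -> is_bilinear_form b ->
  \sum_(k < m.+1) phi (e k) (e k) * b (e k) (e k) =
  \sum_(k < m.+1) phi (e' k) (e' k) * b (e' k) (e' k).
Proof.
move=> sym he he' [b1 b2].
transitivity (\sum_(k < m.+1) \sum_(l < m.+1) phi (e' l) (e' l) *
    (phi (e k) (e k) * (phi (e' l) (e k) * b (e k) (e' l)))).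
  apply: eq_bigr => k _.
  rewrite -[X in _ * X](orthonormal_contract e' _ _ he' (b1 (e k))) mulr_sumr.
  by apply: eq_bigr => l _; rewrite (sym (e k) (e' l)); ring.
rewrite exchange_big /=; apply: eq_bigr => l _.
by rewrite -mulr_sumr (orthonormal_contract e _ _ he (b2 (e' l))).
Qed.

End Contraction.

Arguments orthonormal_contract {R V phi m}.
Arguments orthonormal_riesz {R V phi m}.
Arguments orthonormal_trace_indep {R V phi m}.

(** * Lie algebras whose brackets lie on a null central line *)

Section NullCenter.
Variables (R : realType) (V : vectType R) (m : nat).
Variables (phi omega : V -> V -> R) (z : V) (br nabla : V -> V -> V) (J : V -> V).
Hypothesis lorentzian : is_lorentzian phi m.
Hypothesis brE : forall u v, br u v = omega u v *: z.
Hypothesis omega_bil : is_bilinear_form omega.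
Hypothesis omega_skew : forall u v, omega u v = - omega v u.
Hypothesis omega_z : forall u, omega z u = 0.
Hypothesis null_z : phi z z = 0.
Hypothesis phi_J : forall u w, phi (J u) w = omega u w.
Hypothesis levi_civita : is_levi_civita br phi nabla.

Let phiC u v : phi u v = phi v u. Proof. by case: lorentzian. Qed.
Let phi_bil : is_bilinear_form phi. Proof. by case: lorentzian. Qed.
Let phi_linear w : scalar (phi^~ w). Proof. by case: phi_bil. Qed.
Let phi0 w : phi 0 w = 0.
Proof. by have := phi_linear w (-1) 0 0; rewrite scaler0 addr0; lra. Qed.
Let phiD u v w : phi (u + v) w = phi u w + phi v w.
Proof. by have := phi_linear w 1 u v; rewrite scale1r mul1r. Qed.
Let phiZ a u w : phi (a *: u) w = a * phi u w.
Proof. by have := phi_linear w a u 0; rewrite phi0 !addr0. Qed.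
Let phiN u w : phi (- u) w = - phi u w.
Proof. by rewrite -scaleN1r phiZ mulN1r. Qed.

Lemma form_z_skew_op u : phi z (J u) = 0.
Proof. by rewrite phiC phi_J omega_skew omega_z oppr0. Qed.

Lemma levi_civita_null_center u v x :
  2 * phi (nabla u v) x =
  omega u v * phi z x - phi z v * omega u x - phi z u * omega v x.
Proof.
have [_ ->] := levi_civita.
by rewrite !brE !phiZ (omega_skew x u) (omega_skew x v); ring.
Qed.

Lemma levi_civita_center_l c v : nabla (c *: z) v = 0.
Proof.
case: lorentzian => _ _ nondeg _; apply: nondeg => w.
have omega_cz y : omega (c *: z) y = 0.
  by rewrite omega_skew -phi_J phiC phiZ form_z_skew_op mulr0 oppr0.
have := levi_civita_null_center (c *: z) v w.
by rewrite !omega_cz (phiC z (_ *: z)) phiZ null_z; lra.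
Qed.

(** Pairing with a test vector x keeps the computation scalar: an outer
    derivative hits an inner one only through omega(.,y) = -<.,Jy>, so the
    reduced Koszul formula applies again with Jy as test vector. *)
Lemma curvature_null_center u v w x :
  4 * phi (curvature br nabla u v w) x =
    phi z w * (phi z u * phi (J v) (J x) - phi z v * phi (J u) (J x))
  + phi z x * (phi z v * phi (J u) (J w) - phi z u * phi (J v) (J w)).
Proof.
have nabla_omega a b y : omega (nabla a b) y = - phi (nabla a b) (J y).
  by rewrite omega_skew -phi_J phiC.
have nabla_z a b : phi (nabla a b) z = 0.
  have := levi_civita_null_center a b z.
  by rewrite null_z !(omega_skew _ z) !omega_z; lra.
have nabla_J a b y : 2 * phi (nabla a b) (J y) =
    - (phi z b * phi (J a) (J y)) - phi z a * phi (J b) (J y).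
  by rewrite levi_civita_null_center form_z_skew_op !phi_J; ring.
have second a b c : 4 * phi (nabla a (nabla b c)) x =
    phi z x * (- (phi z c * phi (J a) (J b)) - phi z b * phi (J a) (J c))
    - phi z a * (phi z c * phi (J b) (J x) + phi z b * phi (J c) (J x)).
  have h := levi_civita_null_center a (nabla b c) x.
  have h1 := nabla_J b c a; have h2 := nabla_J b c x.
  move: h; rewrite (omega_skew a) !nabla_omega (phiC z (nabla b c)) nabla_z => h.
  have -> : 4 * phi (nabla a (nabla b c)) x =
    2 * (2 * phi (nabla a (nabla b c)) x) by ring.
  rewrite h.
  transitivity (phi z x * (2 * phi (nabla b c) (J a))
     + phi z a * (2 * phi (nabla b c) (J x))); first by ring.
  by rewrite h1 h2 (phiC (J b) (J a)) (phiC (J c) (J a)); ring.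
rewrite /curvature brE levi_civita_center_l sub0r phiD phiN mulrDr mulrN !second.
by rewrite (phiC (J v) (J u)); ring.
Qed.

(** With its first and third arguments equal to e_k and contracted over k, the
    curvature formula produces <z,z>, g(z,x) and g(z,u), all zero, besides the
    trace of g. *)
Lemma ricci_null_center (e : 'I_m.+1 -> V) u : orthonormal_basis phi e ->
  ricci br phi nabla e u =
  (phi z u / 4 * \sum_(k < m.+1) phi (e k) (e k) * phi (J (e k)) (J (e k))) *: z.
Proof.
move=> he; have [_ _ nondeg _] := lorentzian.
apply/eqP; rewrite -subr_eq0; apply/eqP; apply: nondeg => x.
rewrite phiD phiN phiZ; apply/eqP; rewrite subr_eq0; apply/eqP.
set T := \sum_(k < m.+1) _.
have J_form y : scalar (fun v => phi (J v) (J y)).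
  by move=> a v v'; rewrite !phi_J omega_bil.2.
have cZZ := orthonormal_contract phi_bil e _ z he (phi_bil.1 z).
have cZg y := orthonormal_contract phi_bil e _ z he (J_form y).
rewrite /ricci (scalar_sum _ _ (phi_linear x)).
transitivity ((phi (J u) (J x) *
     (\sum_(k < m.+1) phi (e k) (e k) * (phi z (e k) * phi z (e k)))
  - phi z u *
     (\sum_(k < m.+1) phi (e k) (e k) * (phi z (e k) * phi (J (e k)) (J x)))
  + phi z x * (phi z u * T
  - \sum_(k < m.+1) phi (e k) (e k) * (phi z (e k) * phi (J (e k)) (J u)))) / 4).
  rewrite /T !mulr_sumr -!sumrB mulr_sumr -big_split mulr_suml.
  apply: eq_bigr => k _ /=.
  have := curvature_null_center (e k) u (e k) x.
  rewrite (phiC (J u) (J (e k))) => h.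
  transitivity (phi (e k) (e k) *
    (4 * phi (curvature br nabla (e k) u (e k)) x) / 4); first by field.
  by rewrite h; field.
by rewrite cZZ !cZg null_z !phi_J !omega_z; field.
Qed.

End NullCenter.

(** * Coordinates of the bracket and of the form *)

Section HeisenbergForm.
Variables (R : realType) (n : nat) (sigma : nat -> R).
Hypothesis n_gt0 : (1 <= n)%N.
Hypothesis sigma_gt0 : forall k, (1 <= k < n)%N -> 0 < sigma k.

Local Notation heis := 'rV[R]_(n.*2.+1).
Local Notation fidx := (fidx n).
Local Notation gidx := (gidx n).
Local Notation zidx := (zidx n).
Local Notation f := (heis_f R n).
Local Notation g := (heis_g R n).
Local Notation z := (heis_z R n).
Local Notation phi := (heis_form sigma).
Local Notation v := (frame sigma).

Let n_last : (1 <= n <= n)%N. Proof. by rewrite n_gt0 leqnn. Qed.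
Let zidxE : zidx = n.-1.*2.+2 :> nat. Proof. by move: n_gt0 => /=; lia. Qed.

Lemma fidx_eq k l : (1 <= k <= n)%N -> (1 <= l <= n)%N ->
  (fidx k == fidx l) = (k == l).
Proof. by move=> hk hl; rewrite -val_eqE /= !fidxE //; lia. Qed.

Lemma gidx_eq k l : (1 <= k <= n)%N -> (1 <= l <= n)%N ->
  (gidx k == gidx l) = (k == l).
Proof. by move=> hk hl; rewrite -val_eqE /= !gidxE //; lia. Qed.

Lemma fidx_gidx k l : (1 <= k <= n)%N -> (1 <= l <= n)%N ->
  (fidx k == gidx l) = false.
Proof. by move=> hk hl; rewrite -val_eqE /= fidxE // gidxE //; lia. Qed.

Lemma fidx_zidx k : (1 <= k <= n)%N -> (fidx k == zidx) = false.
Proof. by move=> hk; rewrite -val_eqE /= fidxE //; lia. Qed.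

Lemma gidx_zidx k : (1 <= k <= n)%N -> (gidx k == zidx) = false.
Proof. by move=> hk; rewrite -val_eqE /= gidxE //; lia. Qed.

Definition heis_omega (u w : heis) : R :=
  \sum_(1 <= k < n.+1)
    (u 0 (fidx k) * w 0 (gidx k) - u 0 (gidx k) * w 0 (fidx k)).
Local Notation omega := heis_omega.

Lemma heis_bracket_omega u w : heis_bracket u w = omega u w *: z.
Proof. by []. Qed.

Lemma heis_omega_bilinear : is_bilinear_form omega.
Proof.
split=> u a x y; rewrite /omega mulr_sumr -big_split /=;
  by apply: eq_bigr => k _; rewrite !mxE; ring.
Qed.

Lemma heis_omega_skew u w : omega u w = - omega w u.
Proof. by rewrite /omega -sumrN; apply: eq_bigr => k _; ring. Qed.

Lemma heis_omegaDl u u' w : omega (u + u') w = omega u w + omega u' w.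
Proof. by have := heis_omega_bilinear.2 w 1 u u'; rewrite scale1r mul1r. Qed.

Lemma heis_omegaZl c u w : omega (c *: u) w = c * omega u w.
Proof.
by rewrite /omega mulr_sumr; apply: eq_bigr => k _; rewrite !mxE; ring.
Qed.

Lemma heis_omega_z w : omega z w = 0.
Proof.
rewrite /omega big_nat big1 // => k hk; have {}hk : (1 <= k <= n)%N by [].
by rewrite !mxE fidx_zidx // gidx_zidx //= !mul0r subrr.
Qed.

Lemma heis_omega_f k w : (1 <= k <= n)%N -> omega (f k) w = w 0 (gidx k).
Proof.
move=> hk; rewrite /omega big_nat.
rewrite (eq_bigr (fun l => if l == k then w 0 (gidx l) else 0)).
  by rewrite -big_nat -big_mkcond big_nat1_eq ltnS hk.
move=> l hl; have {}hl : (1 <= l <= n)%N by [].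
rewrite !mxE eqxx /= fidx_eq // (eq_sym _ (fidx k)) fidx_gidx //= mul0r subr0.
by case: eqP; rewrite ?mul1r ?mul0r.
Qed.

Lemma heis_omega_g k w : (1 <= k <= n)%N -> omega (g k) w = - w 0 (fidx k).
Proof.
move=> hk; rewrite /omega big_nat.
rewrite (eq_bigr (fun l => if l == k then - w 0 (fidx l) else 0)).
  by rewrite -big_nat -big_mkcond big_nat1_eq ltnS hk.
move=> l hl; have {}hl : (1 <= l <= n)%N by [].
rewrite !mxE eqxx /= gidx_eq // fidx_gidx //= mul0r sub0r.
by case: eqP; rewrite ?mul1r ?mul0r ?oppr0.
Qed.

(** Every row of the Gram matrix has a single nonzero entry, so pairing with
    a basis vector reads off one coordinate; for z it is that of g_n, and for
    g_n that of z. *)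
Lemma heis_form_delta_l (i p : 'I_(n.*2.+1)) c w :
  (forall j, form_mx n sigma i j = if j == p then c else 0) ->
  phi (delta_mx 0 i) w = c * w 0 p.
Proof.
move=> h; rewrite /heis_form -rowE mxE (bigD1 p) //= big1 => [|j jp].
  by rewrite addr0 [row _ _ _ _]mxE h eqxx [w^T _ _]mxE.
by rewrite [row _ _ _ _]mxE h (negbTE jp) mul0r.
Qed.

Lemma heis_form_f k w : (1 <= k < n)%N -> phi (f k) w = sigma k * w 0 (fidx k).
Proof.
move=> hk; have hk' : (1 <= k <= n)%N by lia.
apply: heis_form_delta_l => j; have hf := fidxE hk'.
rewrite mxE hf ifT; last by lia.
by rewrite doubleK prednK ?(eq_sym j) //; lia.
Qed.

Lemma heis_form_g k w : (1 <= k < n)%N -> phi (g k) w = sigma k * w 0 (gidx k).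
Proof.
move=> hk; have hk' : (1 <= k <= n)%N by lia.
apply: heis_form_delta_l => j; have hg := gidxE hk'.
rewrite mxE hg ifT; last by lia.
have -> : (k.-1.*2.+1)./2 = k.-1 by lia.
by rewrite prednK ?(eq_sym j) //; lia.
Qed.

Lemma heis_form_f_last w : phi (f n) w = w 0 (fidx n).
Proof.
rewrite -[RHS]mul1r; apply: heis_form_delta_l => j; have hf := fidxE n_last.
rewrite mxE hf ltnn subnn -val_eqE /= hf !inE !xpair_eqE /=.
case: ltnP => hj; first by rewrite ifN //; lia.
have -> : (j - n.-1.*2 == 0)%N = (j == n.-1.*2 :> nat) by lia.
by rewrite orbF; case: eqP.
Qed.

Lemma heis_form_g_last w : phi (g n) w = w 0 zidx.
Proof.
rewrite -[RHS]mul1r; apply: heis_form_delta_l => j; have hg := gidxE n_last.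
rewrite mxE hg ifF; last by lia.
have -> : (n.-1.*2.+1 - n.-1.*2 = 1)%N by lia.
have -> : (j == zidx) = (j == n.-1.*2.+2 :> nat) by rewrite -zidxE.
rewrite !inE !xpair_eqE /= orbF.
case: ltnP => hj; first by rewrite ifF //; lia.
have -> : (j - n.-1.*2 == 2)%N = (j == n.-1.*2.+2 :> nat) by lia.
by case: eqP.
Qed.

Lemma heis_form_z w : phi z w = w 0 (gidx n).
Proof.
rewrite -[RHS]mul1r; apply: heis_form_delta_l => j; have hg := gidxE n_last.
rewrite mxE zidxE ifF; last by lia.
have -> : (n.-1.*2.+2 - n.-1.*2 = 2)%N by lia.
rewrite -val_eqE /= hg !inE !xpair_eqE /=.
case: ltnP => hj; first by rewrite ifF //; lia.
have -> : (j - n.-1.*2 == 1)%N = (j == n.-1.*2.+1 :> nat) by lia.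
by case: eqP.
Qed.

Lemma frame_f k : (1 <= k < n)%N -> v (fidx k) = (Num.sqrt (sigma k))^-1 *: f k.
Proof.
move=> hk; have hk' : (1 <= k <= n)%N by lia.
rewrite /frame fidxE // ifT; last by lia.
by rewrite odd_double doubleK prednK //; lia.
Qed.

Lemma frame_g k : (1 <= k < n)%N -> v (gidx k) = (Num.sqrt (sigma k))^-1 *: g k.
Proof.
move=> hk; have hk' : (1 <= k <= n)%N by lia.
rewrite /frame gidxE // ifT; last by lia.
have -> : (k.-1.*2.+1)./2 = k.-1 by lia.
by rewrite /= odd_double prednK //; lia.
Qed.

Lemma frame_f_last : v (fidx n) = f n.
Proof. by rewrite /frame fidxE // ltnn eqxx. Qed.

Lemma frame_g_last : v (gidx n) = (Num.sqrt 2)^-1 *: (g n + z).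
Proof. by rewrite /frame gidxE // eqxx ifF 1?ifF //; lia. Qed.

Lemma frame_z : v zidx = (Num.sqrt 2)^-1 *: (g n - z).
Proof. by rewrite /frame zidxE !ifF //; lia. Qed.

(** Pairs the indices as f_1, g_1, ..., f_n, g_n, with z left over. *)
Lemma sum_heis_index (F : 'I_(n.*2.+1) -> R) :
  \sum_i F i = \sum_(1 <= k < n.+1) (F (fidx k) + F (gidx k)) + F zidx.
Proof.
pose G i := F (inord i).
have pairs q : \sum_(0 <= i < q.*2) G i =
    \sum_(1 <= k < q.+1) (G k.-1.*2 + G k.-1.*2.+1).
  elim: q => [|q IH]; first by rewrite !big_geq.
  by rewrite doubleS [RHS]big_nat_recr // -IH [LHS]big_nat_recr // big_nat_recr //= addrA.
rewrite -/fidx big_ord_recr /= -pairs big_mkord; congr (_ + _).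
apply: eq_bigr => i _; congr F; apply: val_inj.
by rewrite /= inordK // ltnS ltnW.
Qed.

(** * The trace of g in the given frame *)

Section Trace.
Variable J : heis -> heis.
Hypothesis phi_J : forall u w, phi (J u) w = omega u w.

(** By nondegeneracy <Ju,.> = omega(u,.) determines Ju, so an explicit x
    representing omega(u,.) computes <Ju,Ju> without a formula for J. *)
Lemma skew_op_norm u x : (forall w, phi x w = omega u w) ->
  phi (J u) (J u) = omega u x.
Proof. by move=> hx; rewrite phi_J -(hx (J u)) heis_form_sym // phi_J. Qed.

(** Both v_2n and v_(2n+1) have <Jv,Jv> = 1/2, and they enter the trace with
    opposite signs; only the first n - 1 planes contribute, 2 / sigma_k^2 each. *)
Lemma skew_op_trace :
  \sum_i phi (v i) (v i) * phi (J (v i)) (J (v i)) = 8 * alpha n sigma.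
Proof.
have [_ orth] := frame_orthonormal n_gt0 sigma_gt0.
have phiZ c u w : phi (c *: u) w = c * phi u w.
  by rewrite /heis_form -!scalemxAl mxE.
have spacelike i : i != zidx -> phi (v i) (v i) = 1.
  by move=> hi; rewrite orth eqxx (negbTE hi).
have timelike : phi (v zidx) (v zidx) = -1 by rewrite orth !eqxx.
have sigmaK k : (1 <= k < n)%N -> (Num.sqrt (sigma k))^-1 ^+ 2 = (sigma k)^-1.
  by move=> hk; rewrite exprVn sqr_sqrtr // ltW // sigma_gt0.
have sqrt2K : (Num.sqrt 2 : R)^-1 ^+ 2 = 2^-1 by rewrite exprVn sqr_sqrtr.
have norm_f k : (1 <= k < n)%N -> phi (J (v (fidx k))) (J (v (fidx k))) = (sigma k)^-1 ^+ 2.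
  move=> hk; have hk' : (1 <= k <= n)%N by lia.
  have s0 : sigma k != 0 by rewrite gt_eqF // sigma_gt0.
  rewrite frame_f // (skew_op_norm _ ((Num.sqrt (sigma k))^-1 *: ((sigma k)^-1 *: g k))).
    rewrite heis_omegaZl heis_omega_f // !mxE !eqxx /= mulr1 mulrA -expr2.
    by rewrite sigmaK // expr2.
  by move=> w; rewrite !phiZ heis_form_g // heis_omegaZl heis_omega_f // mulKf.
have norm_g k : (1 <= k < n)%N -> phi (J (v (gidx k))) (J (v (gidx k))) = (sigma k)^-1 ^+ 2.
  move=> hk; have hk' : (1 <= k <= n)%N by lia.
  have s0 : sigma k != 0 by rewrite gt_eqF // sigma_gt0.
  rewrite frame_g // (skew_op_norm _ ((Num.sqrt (sigma k))^-1 *: (- (sigma k)^-1 *: f k))).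
    rewrite heis_omegaZl heis_omega_g // !mxE !eqxx /= mulr1 !mulrN opprK mulrA -expr2.
    by rewrite sigmaK // expr2.
  by move=> w; rewrite !phiZ heis_form_f // heis_omegaZl heis_omega_g // mulNr mulKf.
have norm_f_last : phi (J (v (fidx n))) (J (v (fidx n))) = 0.
  rewrite frame_f_last (skew_op_norm _ z).
    by rewrite heis_omega_skew heis_omega_z oppr0.
  by move=> w; rewrite heis_form_z heis_omega_f.
(* J z = 0, so J sends g_n + c z to - f_n for every c. *)
have norm_null c : phi (J ((Num.sqrt 2)^-1 *: (g n + c *: z)))
    (J ((Num.sqrt 2)^-1 *: (g n + c *: z))) = 2^-1.
  rewrite (skew_op_norm _ (- (Num.sqrt 2)^-1 *: f n)).
    rewrite heis_omegaZl heis_omegaDl heis_omega_g // heis_omegaZl heis_omega_z.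
    by rewrite !mxE !eqxx /= mulr0 addr0 mulr1 opprK -expr2 sqrt2K.
  move=> w; rewrite phiZ heis_form_f_last heis_omegaZl heis_omegaDl heis_omega_g //.
  by rewrite heis_omegaZl heis_omega_z; ring.
have norm_g_last : phi (J (v (gidx n))) (J (v (gidx n))) = 2^-1.
  by rewrite frame_g_last -[z]scale1r norm_null.
have norm_z : phi (J (v zidx)) (J (v zidx)) = 2^-1.
  by rewrite frame_z -scaleN1r norm_null.
rewrite sum_heis_index big_nat_recr //= timelike norm_z.
rewrite !spacelike ?fidx_zidx ?gidx_zidx // norm_f_last norm_g_last.
transitivity (\sum_(1 <= k < n) 8 * (1 / (4 * sigma k ^+ 2))); last first.
  by rewrite -mulr_sumr.
rewrite -[RHS]addr0 -addrA; congr (_ + _); last by field.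
apply: eq_big_nat => k hk; have hk' : (1 <= k <= n)%N by lia.
have s0 : sigma k != 0 by rewrite gt_eqF // sigma_gt0.
rewrite !spacelike ?fidx_zidx ?gidx_zidx // norm_f // norm_g //.
by field.
Qed.

End Trace.

(** * The Ricci operator *)

Variables (nabla : heis -> heis -> heis) (e : 'I_(n.*2.+1) -> heis).
Hypothesis levi_civita : is_levi_civita (@heis_bracket R n) phi nabla.
Hypothesis orthonormal_e : orthonormal_basis phi e.

Lemma heis_ricci u :
  ricci (@heis_bracket R n) phi nabla e u = (2 * alpha n sigma * u 0 (gidx n)) *: z.
Proof.
have bil := heis_form_bilinear n sigma.
have sym := heis_form_sym sigma n_gt0.
have frame_on := frame_orthonormal n_gt0 sigma_gt0.
have omega_bil := heis_omega_bilinear.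
pose J u := \sum_k (phi (e k) (e k) * omega u (e k)) *: e k.
have phi_J a w : phi (J a) w = omega a w.
  exact: (orthonormal_riesz bil e (omega a) w sym orthonormal_e (omega_bil.1 a)).
have J_bil : is_bilinear_form (fun a b => phi (J a) (J b)).
  split=> [a c x y|b c x y]; last by rewrite !phi_J omega_bil.2.
  by rewrite !(sym (J a)) !phi_J omega_bil.2.
have null_z : phi z z = 0.
  by rewrite heis_form_z mxE gidx_zidx.
rewrite (ricci_null_center _ _ _ phi omega z _ _ J
  (heis_form_lorentzian n_gt0 sigma_gt0) heis_bracket_omega omega_bil
  heis_omega_skew heis_omega_z null_z phi_J levi_civita) //.
rewrite (orthonormal_trace_indep bil e v _ sym orthonormal_e frame_on J_bil).
by rewrite skew_op_trace // heis_form_z; congr (_ *: _); field.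
Qed.

(** The vectors v_1, ..., v_(2n-1) are orthogonal to z, while the last two
    have the same component 1 / sqrt 2 along g_n, and the difference of the
    last two is sqrt 2 z. *)
Lemma heis_ricci_frame i :
  ricci (@heis_bracket R n) phi nabla e (v i) =
  if (n.*2.-1 <= i)%N then
    alpha n sigma *: v (gidx n) - alpha n sigma *: v zidx else 0.
Proof.
have gE := gidxE n_last.
have diff : alpha n sigma *: v (gidx n) - alpha n sigma *: v zidx =
    (2 * alpha n sigma * (Num.sqrt 2)^-1) *: z.
  rewrite frame_g_last frame_z -scalerBr -scalerBr scalerA.
  rewrite opprB (addrC (g n)) addrACA subrr addr0 -mulr2n -scaler_nat scalerA.
  by congr (_ *: _); ring.
rewrite heis_ricci diff; case: leqP => hi; last first.
  have -> : v i 0 (gidx n) = 0; last by rewrite mulr0 scale0r.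
  rewrite /frame; case: ifP => hi'.
    have hk : (1 <= (i./2).+1 <= n)%N by lia.
    case: ifP => _; rewrite !mxE eqxx /= eq_sym ?gidx_eq ?fidx_gidx ?mulr0 //.
    have -> : (i./2.+1 == n) = false by lia.
    by rewrite mulr0.
  have -> : (i == n.-1.*2 :> nat) by lia.
  by rewrite mxE eqxx eq_sym fidx_gidx.
congr ((_ * _) *: _).
have [->|->] : i = gidx n \/ i = zidx.
- have [hi'|hi'] := eqVneq (i : nat) n.-1.*2.+1.
    by left; apply: val_inj; rewrite /= gE.
  by right; apply: val_inj => /=; have := ltn_ord i; lia.
- by rewrite frame_g_last !mxE !eqxx gidx_zidx //= addr0 mulr1.
- by rewrite frame_z !mxE !eqxx gidx_zidx //= subr0 mulr1.
Qed.

End HeisenbergForm.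

Theorem theorem3p12 (R : realType) (n : nat) (hn : (1 <= n)%N)
  (sigma : nat -> R)
  (sigma_decr : forall j k : nat, (1 <= j)%N -> (j <= k)%N -> (k < n)%N ->
     sigma k <= sigma j)
  (sigma_ge1 : forall k : nat, (1 <= k)%N -> (k < n)%N -> 1 <= sigma k)
  (nabla : 'rV[R]_(n.*2.+1) -> 'rV[R]_(n.*2.+1) -> 'rV[R]_(n.*2.+1))
  (hnabla : is_levi_civita (@heis_bracket R n) (@heis_form R n sigma) nabla)
  (e : 'I_(n.*2.+1) -> 'rV[R]_(n.*2.+1))
  (he : orthonormal_basis (@heis_form R n sigma) e) :
  let Ric := ricci (@heis_bracket R n) (@heis_form R n sigma) nabla e in
  let v := @frame R n sigma in
  let a := @alpha R n sigma in
  represented_by v Ric (@ricci_mx R n sigma) /\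
  (forall i : 'I_(n.*2.+1), (i < n.*2.-1)%N -> Ric (v i) = 0) /\
  Ric (v (inord n.*2.-1)) =
    a *: v (inord n.*2.-1) - a *: v ord_max /\
  Ric (v ord_max) = a *: v (inord n.*2.-1) - a *: v ord_max.
Proof.
move=> Ric v a.
have sigma_gt0 k : (1 <= k < n)%N -> 0 < sigma k.
  by case/andP=> k1 kn; apply: lt_le_trans (sigma_ge1 k k1 kn).
have n_last : (1 <= n <= n)%N by rewrite hn leqnn.
have gE := gidxE n_last.
have ricE i : Ric (v i) =
    if (n.*2.-1 <= i)%N then a *: v (gidx n n) - a *: v ord_max else 0.
  exact: heis_ricci_frame.
have -> : inord n.*2.-1 = gidx n n by congr inord; lia.
split; [split; first by case: (frame_orthonormal hn sigma_gt0) | split; [|split]].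
- move=> j; rewrite ricE; have [hj|hj] := leqP n.*2.-1 j; last first.
    by rewrite big1 // => i _; rewrite mxE (leqNgt _ j) hj andbF scale0r.
  rewrite (bigD1 (gidx n n)) //= (bigD1 ord_max) /=; last first.
    by rewrite eq_sym gidx_zidx.
  rewrite big1 => [|i /andP[ig im]].
    rewrite !mxE hj gE /= gidx_zidx // eqxx !ifT ?scaleNr ?addr0 //; lia.
  rewrite mxE ifF ?scale0r //; apply/negbTE; rewrite negb_and -ltnNge.
  move: ig im; rewrite -!val_eqE /= gE; have := ltn_ord i; lia.
- by move=> i hi; rewrite ricE leqNgt hi.
- by rewrite ricE gE ifT //; lia.
- by rewrite ricE ifT //=; lia.
Qed.
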